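(* Let $q$ be a prime power, $2\le n\le m$, $\mathcal{C}\subseteq\mathrm{Mat}$ a non-zero rank-metric code, and $1\le i\le\dim(\mathcal{C})$ an integer. If $m>n$, then $a_i(\mathcal{C})=\min\{n-\dim(J)\mid J\subseteq\mathbb{F}_q^n\text{ a subspace},\ \dim(\mathcal{C})-m\rho_{\mathrm c}(\mathcal{C},J)\ge i\}$. If $n=m$, then $a_i(\mathcal{C})=\min\{a_i(\mathcal{C},\mathrm c),a_i(\mathcal{C},\mathrm r)\}$, where $a_i(\mathcal{C},\mathrm c)=\min\{n-\dim(J)\mid J\subseteq\mathbb{F}_q^n,\ \dim(\mathcal{C})-m\rho_{\mathrm c}(\mathcal{C},J)\ge i\}$ and $a_i(\mathcal{C},\mathrm r)=\min\{m-\dim(K)\mid K\subseteq\mathbb{F}_q^m,\ \dim(\mathcal{C})-n\rho_{\mathrm r}(\mathcal{C},K)\ge i\}$.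
   Context: $\mathrm{Mat}$ is the $\mathbb{F}_q$-space of $n\times m$ matrices over $\mathbb{F}_q$; a rank-metric code is an $\mathbb{F}_q$-linear subspace. For a code $\mathcal{A}$, $\mathrm{maxrk}(\mathcal{A})=\max\{\mathrm{rk}(M)\mid M\in\mathcal{A}\}$, and $\mathcal{A}$ is an optimal anticode if $\dim\mathcal{A}=m\cdot\mathrm{maxrk}(\mathcal{A})$. The $i$-th generalized weight of a non-zero code is $a_i(\mathcal{C})=\frac1m\min\{\dim\mathcal{A}\mid\mathcal{A}\subseteq\mathrm{Mat}\text{ optimal anticode},\ \dim(\mathcal{C}\cap\mathcal{A})\ge i\}$. For subspaces $J\subseteq\mathbb{F}_q^n$, $K\subseteq\mathbb{F}_q^m$: $\mathcal{C}(J,\mathrm c)=\{M\in\mathcal{C}\mid\mathrm{colsp}(M)\subseteq J\}$, $\mathcal{C}(K,\mathrm r)=\{M\in\mathcal{C}\mid\mathrm{rowsp}(M)\subseteq K\}$, $\rho_{\mathrm c}(\mathcal{C},J)=(\dim\mathcal{C}-\dim\mathcal{C}(J^\perp,\mathrm c))/m$, $\rho_{\mathrm r}(\mathcal{C},K)=(\dim\mathcal{C}-\dim\mathcal{C}(K^\perp,\mathrm r))/n$ ($\perp$ for the standard inner product). *)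

(* Defs.v *)
From HB Require Import structures.
From mathcomp Require Import all_boot all_order all_algebra.
From mathcomp Require Import boolp.
Set Implicit Arguments. Unset Strict Implicit. Unset Printing Implicit Defensive.
Import GRing.Theory Num.Theory.
Local Open Scope ring_scope.

(* Minimum of a set of naturals given as a Prop predicate
   (0 by convention if the set is empty; never used in that case). *)
Lemma natmin_ex (P : nat -> Prop) : (exists k, P k) -> exists k, `[< P k >].
Proof. by case=> k pk; exists k; apply/asboolP. Qed.

Definition natmin (P : nat -> Prop) : nat :=
  match pselect (exists k, P k) with
  | left ex => ex_minn (natmin_ex ex)
  | right _ => 0%N
  end.

Section RankMetric.
Variables (F : finFieldType) (n m : nat).

Definition colsp (M : 'M[F]_(n, m)) : {vspace 'cV[F]_n} :=
  <<[seq col j M | j <- enum 'I_m]>>%VS.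
Definition rowsp (M : 'M[F]_(n, m)) : {vspace 'rV[F]_m} :=
  <<[seq row i M | i <- enum 'I_n]>>%VS.

Definition cdot (u v : 'cV[F]_n) : F := \sum_k u k ord0 * v k ord0.
Definition rdot (u v : 'rV[F]_m) : F := \sum_k u ord0 k * v ord0 k.

Definition cperp (J : {vspace 'cV[F]_n}) : {vspace 'cV[F]_n} :=
  <<[seq v <- enum 'cV[F]_n |
     [forall u : 'cV[F]_n, (u \in J) ==> (cdot u v == 0%R)]]>>%VS.
Definition rperp (K : {vspace 'rV[F]_m}) : {vspace 'rV[F]_m} :=
  <<[seq v <- enum 'rV[F]_m |
     [forall u : 'rV[F]_m, (u \in K) ==> (rdot u v == 0%R)]]>>%VS.

Definition subcode_c (C : {vspace 'M[F]_(n, m)}) (J : {vspace 'cV[F]_n})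
  : {vspace 'M[F]_(n, m)} :=
  <<[seq M <- enum 'M[F]_(n, m) | (M \in C) && (colsp M <= J)%VS]>>%VS.
Definition subcode_r (C : {vspace 'M[F]_(n, m)}) (K : {vspace 'rV[F]_m})
  : {vspace 'M[F]_(n, m)} :=
  <<[seq M <- enum 'M[F]_(n, m) | (M \in C) && (rowsp M <= K)%VS]>>%VS.

Definition rho_c (C : {vspace 'M[F]_(n, m)}) (J : {vspace 'cV[F]_n}) : rat :=
  ((\dim C)%:R - (\dim (subcode_c C (cperp J)))%:R) / m%:R.
Definition rho_r (C : {vspace 'M[F]_(n, m)}) (K : {vspace 'rV[F]_m}) : rat :=
  ((\dim C)%:R - (\dim (subcode_r C (rperp K)))%:R) / n%:R.

Definition maxrk (A : {vspace 'M[F]_(n, m)}) : nat :=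
  (\max_(M : 'M[F]_(n, m) | M \in A) \rank M)%N.

Definition optimal_anticode (A : {vspace 'M[F]_(n, m)}) : Prop :=
  \dim A = (m * maxrk A)%N.

Definition gen_weight (C : {vspace 'M[F]_(n, m)}) (i : nat) : rat :=
  (natmin (fun d => exists A : {vspace 'M[F]_(n, m)},
      [/\ optimal_anticode A, (i <= \dim (C :&: A))%N & \dim A = d]))%:R / m%:R.

Definition gen_weight_c (C : {vspace 'M[F]_(n, m)}) (i : nat) : nat :=
  natmin (fun d => exists J : {vspace 'cV[F]_n},
      i%:R <= (\dim C)%:R - m%:R * rho_c C J /\ d = (n - \dim J)%N).
Definition gen_weight_r (C : {vspace 'M[F]_(n, m)}) (i : nat) : nat :=
  natmin (fun d => exists K : {vspace 'rV[F]_m},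
      i%:R <= (\dim C)%:R - n%:R * rho_r C K /\ d = (m - \dim K)%N).

End RankMetric.

(* Main.v *)
(* Let V be an optimal anticode of maximal rank r.  For a basis x_1, ..., x_m of
   F^m put L_j = { M x_j | M in V, M x_1 = ... = M x_(j-1) = 0 }, so that
   dim V = sum_j dim L_j.  Independent vectors chosen in r+1 different L_j would give
   an element of V of rank at least r+1, so by Rado's theorem some subspace J contains
   all but b of the L_j, with b + dim J <= r.  If dim V = m r this forces either
   L_j = J for all j, or n = m and every L_j is 0 or F^n.

   Let 0 < r < n.  If dim (V x) = r for some x, the first alternative holds for every
   basis starting with x, and comparing bases gives V y = V x for all y: the columns of
   all elements of V lie in one r-dimensional space.  The same applies to the
   transpose of V.  Otherwise n = m and all the L_j, for V and for its transpose, are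
   0 or F^n.  Then take a minimal nonzero subspace W of V cut out by equations
   M x = 0, and let Z be the space of all z with W z = 0.  If Z is a hyperplane, W
   meets every step of the transpose, which makes V everything; if not, a counting
   argument over the finite field finds an element of V of rank r+1.

   Hence optimal anticodes are exactly the spaces of matrices with column space in a
   given J or, for n = m, row space in a given K; both minima are then compared
   through J |-> J^perp. *)

Require Import Defs.
From HB Require Import structures.
From mathcomp Require Import all_boot all_order all_algebra.
From mathcomp Require Import finfield zify boolp.
Import GRing.Theory Num.Theory.
Local Open Scope ring_scope.
Set Implicit Arguments.
Unset Strict Implicit.
Unset Printing Implicit Defensive.

(** * Independent transversals of a sequence of subspaces *)

Lemma sum_saturated (T : eqType) (f : T -> nat) (s : seq T) (c : nat) :
  {in s, forall x, (f x <= c)%N} -> (size s * c <= \sum_(x <- s) f x)%N ->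
  {in s, forall x, f x = c}.
Proof.
elim: s => [|x s IH] //= hf; rewrite big_cons mulSn => hs.
have hx := hf x (mem_head _ _).
have hfs : {in s, forall y, (f y <= c)%N}.
  by move=> y ys; apply: hf; rewrite inE ys orbT.
have : (\sum_(y <- s) f y <= size s * c)%N.
  rewrite -sum1_size big_distrl /= !big_seq; apply: leq_sum => y ys.
  by rewrite mul1n hfs.
move=> hle y; rewrite inE => /orP[/eqP->|]; first by lia.
by apply: IH => //; lia.
Qed.

Section Rado.
Variables (F : fieldType) (E G : vectType F).
Implicit Types (V : {vspace E}) (W X Y J L : {vspace G}) (Ls : seq {vspace G})
  (fs : seq 'Hom(E, G)).

Lemma addvAC : right_commutative (@addv F G).
Proof. by move=> X Y Z; rewrite -!addvA (addvC Y). Qed.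

(** Rado's rank formula in recursive form: each member of [Ls] is either skipped at cost 1 or added
    to [W], and the number skipped plus the final dimension is minimized. *)
Fixpoint rado W Ls : nat :=
  if Ls is L :: Ls' then minn (rado W Ls').+1 (rado (W + L) Ls') else \dim W.

Lemma rado_mono W W' Ls : (W <= W')%VS -> (rado W Ls <= rado W' Ls)%N.
Proof.
elim: Ls W W' => [|L Ls IH] W W' sWW' /=; first exact: dimvS.
by rewrite leq_min !geq_min ltnS IH //= IH ?orbT // addvS.
Qed.

(** Each of the four choices on the right (skip or add [L], for [X] and for [Y]) is matched on the
    left by an induction hypothesis; [m1], [m2], [m3] compare the intersections. *)
Lemma rado_submod X Y Ls :
  (rado (X + Y) Ls + rado (X :&: Y) Ls <= rado X Ls + rado Y Ls)%N.
Proof.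
elim: Ls X Y => [|L Ls IH] X Y /=; first by rewrite dimv_sum_cap.
have hXY := IH X Y.
have hXLYL := IH (X + L)%VS (Y + L)%VS.
have hXLY := IH (X + L)%VS Y.
have hXYL := IH X (Y + L)%VS.
have e1 : (X + L + (Y + L) = X + Y + L)%VS.
  by rewrite addvA (addvAC X) -addvA addvv.
have e2 : (X + L + Y = X + Y + L)%VS by rewrite addvAC.
have e3 : (X + (Y + L) = X + Y + L)%VS by rewrite addvA.
rewrite e1 in hXLYL; rewrite e2 in hXLY; rewrite e3 in hXYL.
have m1 : (rado (X :&: Y) Ls <= rado ((X + L) :&: Y) Ls)%N.
  by apply/rado_mono/capvS; rewrite ?addvSl.
have m2 : (rado (X :&: Y) Ls <= rado (X :&: (Y + L)) Ls)%N.
  by apply/rado_mono/capvS; rewrite ?addvSl.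
have m3 : (rado (X :&: Y + L) Ls <= rado ((X + L) :&: (Y + L)) Ls)%N.
  by apply/rado_mono; rewrite subv_cap !addvS // ?capvSl ?capvSr.
by lia.
Qed.

(** Submodularity gives a closure property: [L] is built from spanning vectors, and [W + <[u]>] and
    [W + <<s>>] meet in a space containing [W]. *)
Lemma rado_closed W L Ls :
  (forall u, u \in L -> (rado (W + <[u]>) Ls <= rado W Ls)%N) ->
  (rado (W + L) Ls <= rado W Ls)%N.
Proof.
move=> hL.
suff gen s : {subset s <= L} -> (rado (W + <<s>>) Ls <= rado W Ls)%N.
  rewrite -{1}(span_basis (vbasisP L)); apply: gen => v; exact: vbasis_mem.
elim: s => [|u s IH] us; first by rewrite span_nil addv0.
have {}IH := IH (fun v vs => us v (@mem_behead _ (u :: s) v vs)).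
have hu := hL u (us u (mem_head _ _)).
rewrite span_cons.
have := rado_submod (W + <[u]>)%VS (W + <<s>>)%VS Ls.
rewrite addvA (addvAC W) addvv -addvA.
have : (rado W Ls <= rado ((W + <[u]>) :&: (W + <<s>>)) Ls)%N.
  by apply: rado_mono; rewrite subv_cap !addvSl.
by lia.
Qed.

(** [J] is [W] plus the members that the minimum adds; a member outside [J] was skipped, hence paid
    for. *)
Lemma rado_attained W Ls : exists2 J, (W <= J)%VS &
  (count (fun L => ~~ (L <= J)%VS) Ls + \dim J <= rado W Ls)%N.
Proof.
elim: Ls W => [|L Ls IH] W /=; first by exists W.
case: (leqP (rado W Ls).+1 (rado (W + L) Ls)) => _.
  have [J WJ hJ] := IH W; exists J => //.
  by case: (_ <= J)%VS => /=; lia.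
have [J WJ hJ] := IH (W + L)%VS; move: WJ; rewrite subv_add => /andP[WJ LJ].
by exists J => //; rewrite LJ /=; lia.
Qed.

Fixpoint jointker V fs : {vspace E} :=
  if fs is f :: fs' then (jointker V fs' :&: lker f)%VS else V.

(** The list is read from its end: each map is restricted to the joint kernel of the maps after it,
    so the steps of a suffix form a suffix. *)
Fixpoint steps V fs : seq {vspace G} :=
  if fs is f :: fs' then (f @: jointker V fs')%VS :: steps V fs' else [::].

Lemma mem_jointker V fs v :
  (v \in jointker V fs) = (v \in V) && all (fun f : 'Hom(E, G) => f v == 0) fs.
Proof.
elim: fs => [|f fs IH] /=; first by rewrite andbT.
by rewrite memv_cap IH memv_ker -andbA; congr (_ && _); rewrite andbC.
Qed.

Lemma size_steps V fs : size (steps V fs) = size fs.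
Proof. by elim: fs => //= f fs ->. Qed.

Lemma steps_cat V fs gs : exists Ls, steps V (fs ++ gs) = Ls ++ steps V gs.
Proof.
elim: fs => [|f fs [Ls IH]]; first by exists [::].
by exists ((f @: jointker V (fs ++ gs))%VS :: Ls); rewrite /= IH.
Qed.

Lemma sum_dim_steps V fs :
  (\sum_(L <- steps V fs) \dim L + \dim (jointker V fs) = \dim V)%N.
Proof.
elim: fs => [|f fs IH] /=; first by rewrite big_nil.
rewrite big_cons -IH -(limg_ker_dim f (jointker V fs)); lia.
Qed.

(* An element realizing the value [k - 1] on the later maps is corrected by a
   vector [u] of the first step: [f v] and [f v + u] cannot both be dependent. *)
Lemma rado_greedy V fs W k : (k <= rado W (steps V fs))%N ->
  exists2 v, v \in V &
    (k <= \dim (W + <<[seq (f : 'Hom(E, G)) v | f <- fs]>>))%N.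
Proof.
elim: fs W k => [|f fs IH] W k /=.
  by move=> hk; exists 0; rewrite ?mem0v // span_nil addv0.
set L := (f @: _)%VS; rewrite leq_min => /andP[hk1 hk2].
case: (leqP k (rado W (steps V fs))) => [/IH[v vV hv]|hk3].
  exists v => //; apply: leq_trans hv _; apply: dimvS.
  by rewrite addvS // span_cons addvSr.
(* The later maps give exactly [k - 1] while adding [L] gives at least [k]; by [rado_closed] a
   single vector of [L] already causes the increase. *)
have [u uL hu] : exists2 u, u \in L & (k <= rado (W + <[u]>) (steps V fs))%N.
  apply: contrapT => hno; have : (rado (W + L) (steps V fs) <= rado W (steps V fs))%N.
    apply: rado_closed => u uL; rewrite leqNgt; apply/negP => hlt.
    by apply: hno; exists u => //; lia.
  by lia.
have [v vV hv] := IH _ _ hu.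
have /memv_imgP[a ak ea] := uL.
move: ak; rewrite mem_jointker => /andP[aV /allP ak].
set T := (W + <<[seq (g : 'Hom(E, G)) v | g <- fs]>>)%VS.
have key w : w \in V -> (forall g, g \in fs -> (g : 'Hom(E, G)) w = g v) ->
   \dim (W + <<[seq (g : 'Hom(E, G)) w | g <- f :: fs]>>) = \dim (T + <[f w]>).
  move=> wV hw; rewrite /= span_cons (addvC <[f w]>%VS) addvA.
  suff -> : [seq (g : 'Hom(E, G)) w | g <- fs] = [seq (g : 'Hom(E, G)) v | g <- fs] by [].
  by apply/eq_in_map.
have hTu : (k <= \dim (T + <[u]>))%N by rewrite /T addvAC.
case: (boolP (f v \in T)) => [fvT|fvT]; last first.
  exists v => //; rewrite key //.
  have : (\dim (T + <[u]>) <= (\dim T).+1)%N.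
    apply: leq_trans (dimv_add_leqif _ _) _.
    by rewrite dim_vline; case: (u != 0); lia.
  suff : (\dim T < \dim (T + <[f v]>))%N by lia.
  rewrite ltnNge; apply: contra fvT => hd.
  have /eqP -> : (T == T + <[f v]>)%VS by rewrite eqEdim addvSl.
  exact: (subvP (addvSr T <[f v]>)) (memv_line _).
exists (v + a); first by rewrite memvD.
rewrite key ?memvD //; last first.
  by move=> g gfs; rewrite linearD /= (eqP (ak g gfs)) addr0.
apply: leq_trans hTu _; apply: dimvS.
rewrite subv_add addvSl /= -memvE linearD /= -ea.
rewrite -[X in X \in _](addKr (f v) u).
by apply: memv_add; rewrite ?memvN ?memv_line.
Qed.

Lemma sum_dim_le Ls J :
  (\sum_(L <- Ls) \dim L <= count (fun L => (L <= J)%VS) Ls * \dim J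
     + count (fun L => ~~ (L <= J)%VS) Ls * dim G)%N.
Proof.
elim: Ls => [|L Ls IH] /=; first by rewrite big_nil.
rewrite big_cons; case: (boolP (L <= J)%VS) => [/dimvS|_] /=; first by lia.
by have := dimvS (subvf L); rewrite dimvf; lia.
Qed.

Lemma rado_bound Ls : (size Ls <= dim G)%N ->
  (\sum_(L <- Ls) \dim L <= dim G * rado 0 Ls)%N.
Proof.
move=> hs; have [J _ hJ] := rado_attained 0 Ls.
apply: leq_trans (sum_dim_le Ls J) _.
have := count_size (fun L => (L <= J)%VS) Ls.
by nia.
Qed.

Lemma rado_dichotomy Ls r : (0 < size Ls)%N -> (dim G <= size Ls)%N ->
  (rado 0 Ls <= r)%N -> (size Ls * r <= \sum_(L <- Ls) \dim L)%N ->
  (exists2 J, \dim J = r & {in Ls, forall L, L = J}) \/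
  (dim G = size Ls /\ {in Ls, forall L, L = 0%VS \/ L = fullv}).
Proof.
move=> s0 hs hr hsum; have [J _ hJ] := rado_attained 0 Ls.
have hle := sum_dim_le Ls J.
have hc := count_predC (fun L => (L <= J)%VS) Ls.
set a := \dim J in hJ hle *; set b := count _ Ls in hJ.
set c := count _ Ls in hle hc.
have {}hc : (c + b = size Ls)%N by exact: hc.
rewrite -/b in hle.
(* With s the length and g = [dim G]: s(a + b) <= s r <= c a + b g, where c = s - b and g <= s;
   hence a b <= 0. *)
have hab : (a * b = 0)%N by nia.
have [b0|b0] := posnP b.
  have hin : {in Ls, forall L, (L <= J)%VS}.
    move=> L LLs; move/eqP: b0; rewrite /b -leqn0 leqNgt -has_count => /hasPn.
    by move=> /(_ L LLs); rewrite negbK.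
  have ar : a = r by nia.
  left; exists J => // L LLs; apply/eqP; rewrite eqEdim hin //=.
  rewrite -/a ar; have -> // := @sum_saturated _ (fun L => \dim L) Ls r.
  by move=> K KLs; rewrite -ar; apply/dimvS/hin.
have {hab} a0 : a = 0%N by move: hab b0; case: (a) => //; nia.
have J0 : J = 0%VS by apply/eqP; rewrite -dimv_eq0 -/a a0.
(* Now s r <= b g with 0 < b <= r leaves g = s; the b nonzero members then have total dimension at
   least b g, so each is full. *)
have eGs : dim G = size Ls by nia.
right; split=> // L LLs.
have [/eqP->|Lneq] := boolP (L == 0%VS); first by left.
right; apply/eqP; rewrite eqEdim subvf dimvf /=.
have hsat := @sum_saturated _ (fun L => \dim L)
  [seq L <- Ls | ~~ (L <= J)%VS] (dim G).
rewrite hsat //; last by rewrite mem_filter J0 subv0 Lneq.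
  by move=> K _; rewrite -dimvf; apply/dimvS/subvf.
rewrite size_filter -/b.
have e : (\sum_(L <- Ls) \dim L = \sum_(L <- [seq L <- Ls | ~~ (L <= J)%VS]) \dim L)%N.
  rewrite big_filter [LHS](bigID (fun L => ~~ (L <= J)%VS)) /= addnC big1 // => K.
  by rewrite negbK J0 subv0 => /eqP->; rewrite dimv0.
by rewrite -e; nia.
Qed.

End Rado.

(** * Steps of a matrix space along a basis *)

(** The completing vectors go in front, so that the steps along [X] end the list of steps along the
    whole basis. *)
Lemma free_complete (F : fieldType) (U : vectType F) (X : seq U) :
  free X -> basis_of fullv (vbasis (<<X>>^C)%VS ++ X).
Proof.
move=> fX; rewrite -(addv_complf <<X>>%VS) addvC; apply: cat_basis.
- by apply/directv_addP; rewrite capvC capv_compl.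
- exact: vbasisP.
- by rewrite /basis_of fX eqxx.
Qed.

Section Columns.
Variables (F : fieldType) (n m : nat).
Implicit Types (V : {vspace 'M[F]_(n, m)}) (X : seq 'cV[F]_m) (M : 'M[F]_(n, m))
  (x y : 'cV[F]_m) (J : {vspace 'cV[F]_n}).

Definition ev x : 'Hom('M[F]_(n, m), 'cV[F]_n) := linfun (mulmxr x).

Lemma evE x M : ev x M = M *m x.
Proof. by rewrite /ev lfunE. Qed.

Definition vanish V X : {vspace 'M[F]_(n, m)} := jointker V (map ev X).
Definition csteps V X : seq {vspace 'cV[F]_n} := steps V (map ev X).

Lemma mem_vanish V X M :
  (M \in vanish V X) = (M \in V) && all (fun x => M *m x == 0) X.
Proof.
rewrite mem_jointker all_map; congr (_ && _).
by apply: eq_all => x /=; rewrite evE.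
Qed.

Lemma vanish_span V X M x : M \in vanish V X -> x \in <<X>>%VS -> M *m x = 0.
Proof.
rewrite mem_vanish => /andP[_ /allP hM].
suff : (<<X>> <= lker (linfun (mulmx M : 'cV_m -> 'cV_n)))%VS.
  by move=> /subvP h /h; rewrite memv_ker lfunE => /eqP.
by apply/span_subvP => y /hM; rewrite memv_ker lfunE.
Qed.

Lemma mulmx_cV_eq0 M : (forall x, M *m x = 0) -> M = 0.
Proof.
move=> h; apply/matrixP => i j; have /matrixP/(_ i 0) := h (delta_mx j 0).
by rewrite -colE !mxE.
Qed.

Lemma vanish_basis V X : <<X>>%VS = fullv -> vanish V X = 0%VS.
Proof.
move=> hX; apply/vspaceP => M; rewrite memv0.
apply/idP/eqP => [hM|->]; last by rewrite mem0v.
by apply: mulmx_cV_eq0 => x; apply: vanish_span hM _; rewrite hX memvf.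
Qed.

Lemma dim_cV k : dim 'cV[F]_k = k.
Proof. by rewrite dim_matrix; apply: muln1. Qed.

Lemma dim_span_cols M X : (\dim <<[seq M *m x | x <- X]>> <= \rank M)%N.
Proof.
set f : 'Hom('cV[F]_(\rank M), 'cV[F]_n) := linfun (mulmx (col_base M)).
have : (\dim (limg f) <= \rank M)%N.
  by have := limg_ker_dim f fullv; rewrite dimvf dim_cV; lia.
apply: leq_trans; apply: dimvS; apply/span_subvP => _ /mapP[x _ ->].
rewrite -{1}(mulmx_base M) -mulmxA.
by apply/memv_imgP; exists (row_base M *m x); rewrite ?memvf // lfunE.
Qed.

(** [rado_greedy] from [W = 0] yields an [M] in [V] whose values on [X] span at least this dimension
    inside its column space. *)
Lemma rado_csteps V r X : {in V, forall M, (\rank M <= r)%N} ->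
  (rado 0 (csteps V X) <= r)%N.
Proof.
move=> hr; have [M MV] := rado_greedy (leqnn (rado 0 (csteps V X))).
rewrite add0v -map_comp => /leq_trans; apply; apply: leq_trans (hr M MV).
apply: leq_trans (dim_span_cols M X); apply: eq_leq; congr (\dim <<_>>).
by apply: eq_map => x /=; rewrite evE.
Qed.

Lemma size_basisf X : basis_of fullv X -> size X = m.
Proof.
by move=> bX; have := @size_basis _ _ _ _ (in_tuple X) bX; rewrite dimvf dim_cV.
Qed.

Lemma csteps_cat V X Y : exists Ls, csteps V (X ++ Y) = Ls ++ csteps V Y.
Proof. by rewrite /csteps map_cat; apply: steps_cat. Qed.

Lemma size_csteps V X : size (csteps V X) = size X.
Proof. by rewrite size_steps size_map. Qed.

Lemma sum_dim_csteps V X :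
  (\sum_(L <- csteps V X) \dim L + \dim (vanish V X) = \dim V)%N.
Proof. exact: sum_dim_steps. Qed.

(** The m steps along a basis add up to [\dim V]; b of them lie outside [J] and have dimension at
    most n <= m, the others at most [\dim J], and [\dim J + b <= r]. *)
Lemma dim_code_le V r : (n <= m)%N -> {in V, forall M, (\rank M <= r)%N} ->
  (\dim V <= m * r)%N.
Proof.
move=> nm hr; set X : seq 'cV[F]_m := vbasis fullv.
have bX : basis_of fullv X by exact: vbasisP.
rewrite -(sum_dim_csteps V X) vanish_basis ?(span_basis bX) // dimv0 addn0.
have [J _ hJ] := rado_attained 0 (csteps V X).
have := sum_dim_le (csteps V X) J; have := rado_csteps X hr.
have := count_predC (fun L => (L <= J)%VS) (csteps V X).
rewrite size_csteps (size_basisf bX) dim_cV /predC /=.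
move: (count _ _) (count _ _) hJ => c b; nia.
Qed.

Lemma csteps_dichotomy V r X : (0 < m)%N -> (n <= m)%N -> 
  {in V, forall M, (\rank M <= r)%N} -> \dim V = (m * r)%N -> free X ->
  (exists2 J, \dim J = r & {in csteps V X, forall L, L = J}) \/
  (n = m /\ {in csteps V X, forall L, L = 0%VS \/ L = fullv}).
Proof.
move=> m0 nm hr dV /free_complete; set Y := vbasis _ ++ X => bY.
have sY := size_basisf bY.
have [|||||] := @rado_dichotomy _ _ (csteps V Y) r;
  rewrite ?size_csteps ?sY ?dim_cV //.
- exact: rado_csteps.
- have := sum_dim_csteps V Y; rewrite vanish_basis ?(span_basis bY) // dimv0.
  by rewrite addn0 => ->; rewrite dV.
- have [Ls ->] := csteps_cat V (vbasis (<<X>>^C)%VS) X.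
  by case=> J dJ hJ; left; exists J => // L LX; apply: hJ; rewrite mem_cat LX orbT.
- have [Ls ->] := csteps_cat V (vbasis (<<X>>^C)%VS) X.
  by case=> e hJ; right; split=> // L LX; apply: hJ; rewrite mem_cat LX orbT.
Qed.

End Columns.

(** * Anticodes with an evaluation image of dimension [r] *)

Section ColumnCase.
Variables (F : fieldType) (n m : nat) (V : {vspace 'M[F]_(n, m)}) (r : nat).
Hypotheses (r_gt0 : (0 < r)%N) (r_lt_n : (r < n)%N) (n_le_m : (n <= m)%N).
Hypotheses (rkV : {in V, forall M, (\rank M <= r)%N}) (dimV : \dim V = (m * r)%N).

Let m_gt0 : (0 < m)%N. Proof. by lia. Qed.

(** The step of the last vector [x] is unrestricted, so it is all of [V x]; its dimension, strictly
    between 0 and n, rules out the second alternative. *)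
Lemma csteps_eq X x : free (X ++ [:: x]) -> \dim (ev n x @: V) = r ->
  {in csteps V (X ++ [:: x]), forall L, L = (ev n x @: V)%VS}.
Proof.
move=> fX dx; have [Ls eLs] := csteps_cat V X [:: x].
have xin : (ev n x @: V)%VS \in csteps V (X ++ [:: x]).
  by rewrite eLs mem_cat /= inE eqxx orbT.
have [[J dJ hJ]|[_ h01]] := csteps_dichotomy m_gt0 n_le_m rkV dimV fX.
  by move=> L /hJ ->; rewrite (hJ _ xin).
case: (h01 _ xin) dx => ->; first by rewrite dimv0; lia.
by rewrite dimvf dim_cV; lia.
Qed.

Lemma csteps_0f X x : free (X ++ [:: x]) -> \dim (ev n x @: V) != r ->
  n = m /\ {in csteps V (X ++ [:: x]), forall L, L = 0%VS \/ L = fullv}.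
Proof.
move=> fX dx; have [Ls eLs] := csteps_cat V X [:: x].
have xin : (ev n x @: V)%VS \in csteps V (X ++ [:: x]).
  by rewrite eLs mem_cat /= inE eqxx orbT.
have [[J dJ hJ]|//] := csteps_dichotomy m_gt0 n_le_m rkV dimV fX.
by case/eqP: dx; rewrite (hJ _ xin).
Qed.

Lemma sum_dim_0f (Ls : seq {vspace 'cV[F]_n}) :
  {in Ls, forall L, L = 0%VS \/ L = fullv} -> (n %| \sum_(L <- Ls) \dim L)%N.
Proof.
move=> h; rewrite big_seq; apply: dvdn_sum => L /h [->|->].
  by rewrite dimv0 dvdn0.
by rewrite dimvf dim_cV.
Qed.

Lemma eq_vanish X Y : X =i Y -> vanish V X = vanish V Y.
Proof.
by move=> eXY; apply/vspaceP => M; rewrite !mem_vanish (eq_all_r eXY).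
Qed.

Lemma column_case x : \dim (ev n x @: V) = r ->
  exists2 J : {vspace 'cV[F]_n}, \dim J = r &
    {in V, forall M, forall y, M *m y \in J}.
Proof.
move=> dx; set J := (ev n x @: V)%VS in dx; exists J => // M MV y.
have inJ N : N \in V -> N *m x \in J by move=> NV; rewrite -evE memv_img.
have [/vlineP[k ->]|yx] := boolP (y \in <[x]>%VS).
  by rewrite -scalemxAr memvZ ?inJ.
have x0 : x != 0.
  apply/eqP => x0; move: dx; suff -> : J = 0%VS by rewrite dimv0; lia.
  apply/eqP; rewrite -subv0; apply/subvP => _ /memv_imgP[N _ ->].
  by rewrite evE x0 mulmx0 mem0v.
have fyx : free ([:: y] ++ [:: x]).
  by rewrite /= free_cons span_seq1 yx seq1_free.
have stJ := csteps_eq fyx dx.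
have eyJ : (ev n y @: vanish V [:: x])%VS = J by apply: stJ; rewrite inE eqxx.
have JleY : (J <= ev n y @: V)%VS.
  by rewrite -eyJ; apply/limgS/subvP => N; rewrite mem_vanish => /andP[].
suff -> : J = (ev n y @: V)%VS by rewrite -evE memv_img.
apply/eqP; rewrite eqEsubv JleY /=; apply/subvP => _ /memv_imgP[N NV ->].
have [dy|dy] := boolP (\dim (ev n y @: V)%VS == r).
  have /eqP -> : J == (ev n y @: V)%VS by rewrite eqEdim JleY (eqP dy) dx leqnn.
  exact: memv_img.
(* For r > 1: sums of steps depend only on the set of vectors. They are 2r and 3r for lists ending
   in [x], and multiples of n for lists ending in [y], so n divides r, against 0 < r < n. *)
case: (ltngtP r 1) => [|r_gt1|r1]; first by lia.
  have [z zxy] : exists z, z \notin <<[:: x; y]>>%VS.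
    apply: contrapT => hz; have hf : (fullv <= <<[:: x; y]>>)%VS.
      apply/subvP => z _; apply: contrapT => hz'; apply: hz; exists z.
      exact/negP.
    have := leq_trans (dimvS hf) (dim_span _).
    by rewrite dimvf dim_cV /=; lia.
  have pxy : perm_eq [:: x; y] [:: y; x] := permEl (perm_catC [:: x] [:: y]).
  have fxy : free [:: x; y] by rewrite (perm_free pxy).
  have fzxy : free [:: z; x; y] by rewrite free_cons zxy.
  have fzyx : free ([:: z; y] ++ [:: x]).
    by rewrite /= free_cons -(eq_span (perm_mem pxy)) zxy.
  have s2 : (\sum_(L <- csteps V [:: y; x]) \dim L = 2 * r)%N.
    rewrite big_seq (eq_bigr (fun=> r)) => [|L /stJ -> //].
    by rewrite -big_seq big_const_seq count_predT iter_addn_0 mulnC.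
  have s3 : (\sum_(L <- csteps V [:: z; y; x]) \dim L = 3 * r)%N.
    rewrite big_seq (eq_bigr (fun=> r)) => [|L /(csteps_eq fzyx dx) -> //].
    by rewrite -big_seq big_const_seq count_predT iter_addn_0 mulnC.
  have [_ /sum_dim_0f d2] := @csteps_0f [:: x] y fxy dy.
  have [_ /sum_dim_0f d3] := @csteps_0f [:: z; x] y fzxy dy.
  have e2 : vanish V [:: x; y] = vanish V [:: y; x].
    by apply: eq_vanish => u; rewrite !inE orbC.
  have e3 : vanish V [:: z; x; y] = vanish V [:: z; y; x].
    by apply: eq_vanish => u; rewrite !inE [(_ == x) || _]orbC.
  have same X Y : vanish V X = vanish V Y ->
      (\sum_(L <- csteps V X) \dim L = \sum_(L <- csteps V Y) \dim L)%N.
    move=> e; apply/eqP.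
    by rewrite -(eqn_add2r (\dim (vanish V X))) {2}e !sum_dim_csteps.
  move: d2 d3; rewrite (same _ _ e2) (same _ _ e3) s2 s3.
  move=> d2 d3; have := dvdn_sub d3 d2; rewrite -mulnBl mul1n => /dvdn_leq.
  by move=> /(_ r_gt0); rewrite leqNgt r_lt_n.
(* For r = 1: if [N] kills [x], it sends [y] into the step [J]; otherwise [N *m x] spans the line
   [J], and [N *m y] outside it would give rank 2. *)
have [Nx0|Nx0] := boolP (N *m x == 0).
  by rewrite -eyJ memv_img // mem_vanish NV /= Nx0.
have eJ : J = <[N *m x]>%VS.
  by apply/eqP; rewrite eq_sym eqEdim -memvE inJ //= dx dim_vline Nx0 r1.
rewrite eJ evE; apply: contrapT => /negP hN.
have fN : free [:: N *m y; N *m x] by rewrite free_cons span_seq1 hN seq1_free.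
have := leq_trans (dim_span_cols N [:: y; x]) (rkV NV).
by rewrite /= (eqP fN) r1.
Qed.

End ColumnCase.

(** * Transposition of matrix spaces *)

Section Transpose.
Variables (F : fieldType) (a b : nat).
Implicit Type V : {vspace 'M[F]_(a, b)}.

Definition trv V : {vspace 'M[F]_(b, a)} := (linfun (@trmx F a b) @: V)%VS.

Lemma mem_trv V M : (M \in trv V) = (M^T \in V).
Proof.
apply/memv_imgP/idP => [[N NV ->]|MV]; first by rewrite lfunE /= trmxK.
by exists M^T => //; rewrite lfunE /= trmxK.
Qed.

Lemma dim_trv V : \dim (trv V) = \dim V.
Proof.
apply: limg_dim_eq; apply/eqP; rewrite -subv0; apply/subvP => M.
by rewrite memv_cap memv_ker lfunE memv0 => /andP[_]; rewrite trmx_eq0.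
Qed.

End Transpose.

Lemma trvK (F : fieldType) (a b : nat) : cancel (@trv F a b) (@trv F b a).
Proof. by move=> V; apply/vspaceP => M; rewrite !mem_trv trmxK. Qed.

Lemma dim_addv_line (F : fieldType) (vT : vectType F) (Z : {vspace vT}) v :
  v \notin Z -> \dim (<[v]> + Z) = (\dim Z).+1.
Proof.
move=> vZ; rewrite dimv_disjoint_sum.
  by rewrite dim_vline; case: eqP vZ => // ->; rewrite mem0v.
apply/eqP; rewrite -subv0; apply/subvP => u; rewrite memv_cap memv0.
case/andP=> /vlineP[c ->]; have [->|c0] := eqVneq c 0; first by rewrite scale0r.
move=> /(memvZ c^-1); rewrite scalerA mulVf // scale1r => vZ'.
by rewrite vZ' in vZ.
Qed.

(* If every [w] in [W] failed, then [p + f w \in U] or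
   [q + g w - c *: (p + f w) \in U] for some scalar [c]; each of these [#|F| + 1]
   conditions holds for at most [#|U|] vectors [w], too few to exhaust [W]. *)
Lemma avoid_subspace (F : finFieldType) (k l n : nat)
    (W : {vspace 'M[F]_(k, l)}) (U : {vspace 'cV[F]_n})
    (f g : 'Hom('M[F]_(k, l), 'cV[F]_n)) (p q : 'cV[F]_n) :
  (W :&: lker f = 0)%VS -> (forall c, (W :&: lker (g - c *: f) = 0)%VS) ->
  ((\dim U).+2 <= \dim W)%N ->
  exists2 w, w \in W &
    (\dim U).+2 = \dim (<[q + g w]> + (<[p + f w]> + U)).
Proof.
move=> kf kg dUW; apply: contrapT => hno.
have bad w : w \in W -> p + f w \notin U ->
    exists c, q + g w - c *: (p + f w) \in U.
  move=> wW pU; apply: contrapT => hc; apply: hno; exists w => //.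
  rewrite !dim_addv_line //; apply/negP => /memv_addP[_ /vlineP[c ->] [u uU eu]].
  by apply: hc; exists c; rewrite eu addrC addKr.
pose c_of w := odflt 0 [pick c | q + g w - c *: (p + f w) \in U].
have c_ofP w : w \in W -> p + f w \notin U ->
    q + g w - c_of w *: (p + f w) \in U.
  move=> wW /(bad w wW)[c hc]; rewrite /c_of.
  by case: pickP => // /(_ c); rewrite hc.
pose phi w : option F * 'cV[F]_n :=
  if p + f w \in U then (None, p + f w)
  else (Some (c_of w), q + g w - c_of w *: (p + f w)).
have inj : {in W &, injective phi}.
  move=> v w vW wW; rewrite /phi; case: ifP => pv; case: ifP => pw // [].
    move/addrI => e; apply/eqP; rewrite -subr_eq0 -memv0 -kf memv_cap memvB //=.
    by rewrite memv_ker linearB /= e subrr.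
  have shift c u : q + g u - c *: (p + f u) = (q - c *: p) + (g - c *: f) u.
    by rewrite add_lfunE opp_lfunE scale_lfunE scalerDr opprD addrACA.
  move=> ->; rewrite !shift => /addrI e; apply/eqP.
  rewrite -subr_eq0 -memv0 -(kg (c_of w)) memv_cap memvB //= memv_ker.
  by rewrite linearB /= e subrr.
have sub : phi @: W \subset setX [set: option F] [set u | u \in U].
  apply/subsetP => _ /imsetP[w wW ->]; rewrite /phi !inE.
  by case: ifP => //= /negbT /(c_ofP _ wW).
have := subset_leq_card sub; rewrite (card_in_imset inj) cardsX cardsT card_option.
rewrite cardsE (card_vspace W) (card_vspace U).
have q2 : (1 < #|F|)%N by exact: finNzRing_gt1.
move: (#|F|) q2 => s s2 hle.
have : (s ^ (\dim U).+2 <= s ^ \dim W)%N by rewrite leq_exp2l.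
rewrite !expnS => h1; have := leq_trans h1 hle.
have : (0 < s ^ \dim U)%N by rewrite expn_gt0 (ltnW s2).
(* The count would require s * s <= s + 1, which fails for s >= 2. *)
move: (s ^ _)%N => t t0; rewrite mulnA leq_pmul2r //; nia.
Qed.

Lemma steps_neq0 (F : fieldType) (E G : vectType F) (V W : {vspace E})
    (fs : seq 'Hom(E, G)) :
  (W <= V)%VS -> 0%VS \notin steps W fs -> 0%VS \notin steps V fs.
Proof.
move=> WV; elim: fs => [|f fs IH]; first by [].
have stepsE U : steps U (f :: fs) = (f @: jointker U fs)%VS :: steps U fs by [].
rewrite !stepsE !in_cons !negb_or => /andP[h0 hW]; apply/andP; split; last exact: IH.
apply: contra h0 => /eqP e0; rewrite eq_sym -subv0 e0; apply/limgS/subvP => v.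
by rewrite !mem_jointker => /andP[/(subvP WV) -> ->].
Qed.

Lemma mem_steps (F : fieldType) (E G : vectType F) (V : {vspace E})
    (fs : seq 'Hom(E, G)) L :
  L \in steps V fs -> exists2 f, f \in fs & (L <= f @: V)%VS.
Proof.
elim: fs => [|f fs IH] //=; rewrite inE => /orP[/eqP->|/IH[g gfs hg]].
  exists f; rewrite ?inE ?eqxx //; apply/limgS/subvP => v.
  by rewrite mem_jointker => /andP[].
by exists g; rewrite // inE gfs orbT.
Qed.

(** * Square matrices with no evaluation image of dimension [r] *)

Section Square.
Variables (F : finFieldType) (n r : nat).
Hypotheses (r_gt0 : (0 < r)%N) (r_lt_n : (r < n)%N).
Implicit Types (V W : {vspace 'M[F]_n}) (x y : 'cV[F]_n).

Let n_gt0 : (0 < n)%N. Proof. by lia. Qed.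

(** The step of [x] heads the list, whereas [csteps_0f] inspects the last vector: [x] itself if [X]
    is empty, the last entry of [X] otherwise. *)
Lemma ev_vanish_0f V X x : {in V, forall M, (\rank M <= r)%N} ->
  \dim V = (n * r)%N -> (forall x, \dim (ev n x @: V) != r) -> free (x :: X) ->
  (ev n x @: vanish V X = 0 \/ ev n x @: vanish V X = fullv)%VS.
Proof.
move=> rkV dV hV; case: (lastP X) => [|Y y] fX.
  have [_ h] := csteps_0f (X := [::]) r_gt0 r_lt_n (leqnn n) rkV dV fX (hV x).
  by apply: h; rewrite inE eqxx.
move: fX; rewrite -cats1 => fX.
have [_ h] := csteps_0f (X := x :: Y) r_gt0 r_lt_n (leqnn n) rkV dV fX (hV y).
by apply: h; rewrite inE eqxx.
Qed.

Lemma exists_minimal_vanish V : V != 0%VS -> exists X,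
  [/\ free X, vanish V X != 0%VS & forall Y, free Y -> vanish V Y != 0%VS ->
     (\dim (vanish V X) <= \dim (vanish V Y))%N].
Proof.
move=> V0; pose P k := `[< exists X,
  [/\ free X, vanish V X != 0%VS & \dim (vanish V X) = k] >].
have exP : exists k, P k.
  by exists (\dim V); apply/asboolP; exists [::]; rewrite nil_free.
case: (ex_minnP exP) => k /asboolP[X [fX X0 dX]] hmin; exists X; split=> // Y fY Y0.
by rewrite dX; apply: hmin; apply/asboolP; exists Y.
Qed.

(* If [W] kills a space [Z] of codimension at least 2, some [M] in [V] maps [Z] onto a
   space of dimension at least [r - 1], and a suitable [w] in [W] makes [M + w] gain two
   more dimensions outside [Z]. *)
Lemma square_case V : {in V, forall M, (\rank M <= r)%N} ->
  \dim V = (n * r)%N -> (forall x, \dim (ev n x @: V) != r) ->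
  (forall x, \dim (ev n x @: trv V) != r) -> False.
Proof.
move=> rkV dV hc hr.
have V0 : V != 0%VS by rewrite -dimv_eq0 dV; lia.
have rkT : {in trv V, forall M, (\rank M <= r)%N}.
  by move=> M; rewrite mem_trv -mxrank_tr => /rkV.
have dT : \dim (trv V) = (n * r)%N by rewrite dim_trv.
have [X [fX X0 minX]] := exists_minimal_vanish V0.
set W := vanish V X in X0 minX.
have WV : (W <= V)%VS by apply/subvP => M; rewrite mem_vanish => /andP[].
pose wh (w : 'M[F]_n) := linfun (mulmx w : 'cV_n -> 'cV_n).
have whE w z : wh w z = w *m z by rewrite lfunE.
pose Z : {vspace 'cV[F]_n} := (\bigcap_(w : 'M[F]_n | w \in W) lker (wh w))%VS.
have inZ z : reflect (forall w, w \in W -> w *m z = 0) (z \in Z).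
  rewrite memvE; apply: (iffP subv_bigcapP) => h w wW.
    by have := h w wW; rewrite -memvE memv_ker whE => /eqP.
  by rewrite -memvE memv_ker whE h.
have XZ : (<<X>> <= Z)%VS.
  by apply/subvP => z zX; apply/inZ => w wW; apply: vanish_span wW zX.
(* The step of [x] after [X] is nonzero, hence full; a nonzero kernel would be a smaller space of
   the form [vanish V Y], against minimality. *)
have outZ x : x \notin Z -> (W :&: lker (ev n x) = 0)%VS /\ (ev n x @: W = fullv)%VS.
  move=> xZ; have fxX : free (x :: X).
    by rewrite free_cons fX andbT; apply: contra xZ => /(subvP XZ).
  have evW : (ev n x @: W = fullv)%VS.
    case: (ev_vanish_0f rkV dV hc fxX) => // e0; case/negP: xZ; apply/inZ => w wW.
    by apply/eqP; rewrite -memv0 -e0 -evE memv_img.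
  split=> //; apply/eqP/negPn/negP => n0.
  have := minX (x :: X) fxX n0; rewrite leqNgt => /negP; apply.
  by rewrite -/W -(limg_ker_dim (ev n x) W) evW dimvf dim_cV -addn1 leq_add2l.
have [x xZ] : exists x, x \notin Z.
  apply: contrapT => hx; move/eqP: X0; apply.
  apply/eqP; rewrite -subv0; apply/subvP => w wW.
  rewrite memv0; apply/eqP/mulmx_cV_eq0 => z; apply: (inZ z _ w wW).
  by apply: contrapT => hz; apply: hx; exists z; apply/negP.
have [kx evx] := outZ x xZ.
have dW : \dim W = n by rewrite -(limg_dim_eq kx) evx dimvf dim_cV.
have [hZx|/subvPn[y _ yZx]] := boolP (fullv <= Z + <[x]>)%VS.
  (* Here [Z] and [x] span everything, so [w] in [W] is determined by [w *m x], and [w^T *m u] by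
     the scalar obtained on multiplying with [x^T]. *)
  have dWT u : (\dim (ev n u @: trv W) <= 1)%N.
    pose h := linfun (mulmx x^T : 'cV[F]_n -> 'cV[F]_1).
    suff kh : ((ev n u @: trv W) :&: lker h = 0)%VS.
      rewrite -(limg_dim_eq kh); apply: leq_trans (dimvS (subvf _)) _.
      by rewrite dimvf dim_cV.
    apply/eqP; rewrite -subv0; apply/subvP => v; rewrite memv_cap memv_ker lfunE /=.
    case/andP=> /memv_imgP[w]; rewrite mem_trv => wW ->; rewrite evE memv0 => /eqP hx.
    rewrite -trmx_eq0; apply/eqP/mulmx_cV_eq0 => z.
    have /(subvP hZx)/memv_addP[z0 z0Z [_ /vlineP[c ->] ->]] := memvf z.
    rewrite trmx_mul mulmxDr -scalemxAr -[_ *m z0]mulmxA (inZ z0 z0Z _ wW) mulmx0 add0r.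
    by rewrite -trmx_mul -[X in c *: X]trmxK trmx_mul trmxK hx trmx0 scaler0.
  have [Y bY] : exists Y : seq 'cV[F]_n, basis_of fullv Y.
    by exists (vbasis fullv); apply: vbasisP.
  (* The n steps have dimension at most 1 and total n, so none vanishes. The larger steps of [trv V]
     are then all full, with total n * n instead of n * r. *)
  have W01 : 0%VS \notin csteps (trv W) Y.
    have := sum_dim_csteps (trv W) Y.
    rewrite vanish_basis ?(span_basis bY) // dimv0 addn0 dim_trv dW => sW.
    apply/negP => h0.
    have := @sum_saturated _ (fun L => \dim L) (csteps (trv W) Y) 1 _ _ 0%VS h0.
    rewrite dimv0 => h; suff: 0%N = 1%N by [].
    apply: h; last by rewrite size_csteps (size_basisf bY) muln1 sW.
    move=> L /mem_steps[_ /mapP[u _ ->] hL].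
    exact: leq_trans (dimvS hL) (dWT u).
  have V01 : 0%VS \notin csteps (trv V) Y.
    by apply: steps_neq0 W01; apply: limgS.
  have sV := sum_dim_csteps (trv V) Y.
  rewrite vanish_basis ?(span_basis bY) // dimv0 addn0 dT in sV.
  have h0f : {in csteps (trv V) Y, forall L, L = 0%VS \/ L = fullv}.
    have := basis_free bY; case/lastP: (Y) => [_ L|Y' u]; first by rewrite in_nil.
    rewrite -cats1 => fY.
    by have [_] := csteps_0f r_gt0 r_lt_n (leqnn n) rkT dT fY (hr u).
  have : (\sum_(L <- csteps (trv V) Y) \dim L = n * n)%N.
    rewrite big_seq (eq_bigr (fun=> n)) => [|L LY].
      rewrite -big_seq big_const_seq count_predT iter_addn_0.
      by rewrite size_csteps (size_basisf bY).
    case: (h0f L LY) => eL; first by case/negP: V01; rewrite -eL.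
    by rewrite eL dimvf dim_cV.
  rewrite sV => /eqP; rewrite eqn_pmul2l // => /eqP er.
  by have := r_lt_n; rewrite er ltnn.
pose B : seq 'cV[F]_n := vbasis Z.
have bB : basis_of Z B by exact: vbasisP.
have dZ : (size B <= n)%N.
  have := @size_basis _ _ _ _ (in_tuple B) bB => <-.
  by rewrite -[X in (_ <= X)%N](dim_cV F n) -dimvf dimvS ?subvf.
have WB : vanish V B = W.
  apply/vspaceP => w; apply/idP/idP => hw.
    rewrite mem_vanish; have := hw; rewrite mem_vanish => /andP[-> _] /=.
    apply/allP => z zX; apply/eqP; apply: vanish_span hw _.
    by rewrite (span_basis bB); apply: (subvP XZ); apply: memv_span.
  rewrite mem_vanish (subvP WV) //=; apply/allP => z zB; apply/eqP.
  by apply: (inZ z _ w hw); apply: basis_mem bB zB.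
(* As [vanish V B] is [W], of dimension n, the at most n steps along [B] total n(r - 1). *)
have hrado : (r.-1 <= rado 0 (csteps V B))%N.
  have := @rado_bound _ _ (csteps V B); rewrite size_csteps dim_cV => /(_ dZ).
  by have := sum_dim_csteps V B; rewrite WB dV dW; nia.
have [M MV] := rado_greedy hrado; rewrite add0v -map_comp.
set U0 := <<_>>%VS.
have {U0}-> : U0 = <<[seq M *m z | z <- B]>>%VS.
  by congr (<<_>>)%VS; apply: eq_map => z /=; rewrite evE.
set U := <<_>>%VS => dU.
have UW w Y : w \in W -> (\dim (<<[seq (M + w) *m z | z <- Y]>> + U) <= r)%N.
  move=> wW; have MwV : M + w \in V by rewrite memvD // (subvP WV).
  apply: leq_trans (rkV _ MwV); apply: leq_trans (dim_span_cols (M + w) (Y ++ B)).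
  rewrite map_cat span_cat; apply/dimvS/addvS => //.
  apply/span_subvP => _ /mapP[z zB ->]; apply: memv_span; apply/mapP; exists z => //.
  by rewrite mulmxDl (inZ z (basis_mem bB zB) w wW) addr0.
have dUr : (\dim U <= r)%N by have := UW 0 [::] (mem0v _); rewrite /= span_nil add0v.
have [dUeq|dUlt] : (\dim U = r \/ (\dim U).+1 = r)%N.
  have {}dU : (r.-1 <= \dim U)%N := dU.
  move: dU dUr r_gt0; move: (\dim U) => d; clear; lia.
  have [v _ vU] : exists2 v, v \in fullv & v \notin U.
    by apply/subvPn/negP => /dimvS; rewrite dimvf dim_cV dUeq leqNgt r_lt_n.
  have : v - M *m x \in (ev n x @: W)%VS by rewrite evx memvf.
  case/memv_imgP=> w wW; rewrite evE => ew.
  have := UW w [:: x] wW; rewrite /= span_seq1 mulmxDl -ew addrC subrK.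
  by rewrite dim_addv_line // dUeq ltnn.
(* Since [y] avoids [Z + <[x]>], every [y - c *: x] stays outside [Z], where evaluation is injective
   on [W]. *)
have kg c : (W :&: lker (ev n y - c *: ev n x) = 0)%VS.
  have -> : ev n y - c *: ev n x = ev n (y - c *: x).
    apply/lfunP => w; rewrite add_lfunE opp_lfunE scale_lfunE !evE.
    by rewrite mulmxBr scalemxAr.
  apply: (proj1 (outZ _ _)); apply: contra yZx => yZ.
  by rewrite -[y](subrK (c *: x)) memv_add // memvZ // memv_line.
have [|w wW] := @avoid_subspace _ _ _ _ W U _ _ (M *m x) (M *m y) kx kg.
  by rewrite dW dUlt.
move=> dw; have := UW w [:: y; x] wW; rewrite /= span_cons span_seq1 -addvA.
by move: dw; rewrite !evE -!mulmxDl => <-; rewrite -dUlt ltnn.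
Qed.

End Square.

(** * Codes with prescribed column space *)

Section ColumnCodes.
Variables (F : finFieldType) (n m : nat).
Implicit Types (C V : {vspace 'M[F]_(n, m)}) (M : 'M[F]_(n, m)) (J : {vspace 'cV[F]_n}).

Definition colcode J : {vspace 'M[F]_(n, m)} :=
  (\bigcap_(y : 'cV[F]_m) (ev n y @^-1: J))%VS.

Lemma mem_colcode J M : reflect (forall y, M *m y \in J) (M \in colcode J).
Proof.
rewrite memvE; apply: (iffP subv_bigcapP) => h y.
  by have := h y isT; rewrite -memvE -memv_preim evE.
by move=> _; rewrite -memvE -memv_preim evE.
Qed.

Lemma mulmx_sum_col k (B : 'M[F]_(n, k)) (y : 'cV[F]_k) :
  B *m y = \sum_j y j 0 *: col j B.
Proof.
by apply/colP => i; rewrite !mxE summxE; apply: eq_bigr => j _; rewrite !mxE mulrC.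
Qed.

Lemma colsp_sub J M : (colsp M <= J)%VS = (M \in colcode J).
Proof.
apply/span_subvP/mem_colcode => [h y|h _ /mapP[j _ ->]]; last by rewrite colE.
rewrite mulmx_sum_col; apply: memv_suml => j _; apply/memvZ/h.
by apply: map_f; rewrite mem_enum.
Qed.

Lemma subcode_cE C J : subcode_c C J = (C :&: colcode J)%VS.
Proof.
apply/eqP; rewrite eqEsubv; apply/andP; split.
  by apply/span_subvP => M; rewrite mem_filter memv_cap colsp_sub => /andP[].
apply/subvP => M; rewrite memv_cap => hM; apply: memv_span.
by rewrite mem_filter mem_enum colsp_sub hM.
Qed.

Definition basis_mx J : 'M[F]_(n, \dim J) := \matrix_(i, j) (vbasis J)`_j i 0.

Lemma col_basis_mx J j : col j (basis_mx J) = (vbasis J)`_j.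
Proof. by apply/colP => i; rewrite !mxE. Qed.

Lemma basis_mx_inj J (y : 'cV[F]_(\dim J)) : basis_mx J *m y = 0 -> y = 0.
Proof.
rewrite mulmx_sum_col => h; apply/colP => i; rewrite mxE.
have /freeP/(_ (fun j => y j 0)) hf := basis_free (vbasisP J).
by apply: hf; rewrite -[RHS]h; apply: eq_bigr => j _; rewrite col_basis_mx.
Qed.

Lemma basis_mx_factor J M : M \in colcode J ->
  exists X : 'M[F]_(\dim J, m), M = basis_mx J *m X.
Proof.
move=> /mem_colcode h; exists (\matrix_(i, j) coord (vbasis J) i (col j M)).
apply/matrixP => i j.
have /coord_vbasis/matrixP/(_ i 0) : col j M \in J by rewrite colE.
rewrite mxE => ->; rewrite summxE !mxE; apply: eq_bigr => k _.
by rewrite !mxE mulrC.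
Qed.

(** Left multiplication by [basis_mx J] identifies all [\dim J] by m matrices with [colcode J]. *)
Lemma dim_colcode J : \dim (colcode J) = (m * \dim J)%N.
Proof.
pose f : 'Hom('M[F]_(\dim J, m), 'M[F]_(n, m)) := linfun (mulmx (basis_mx J)).
have -> : colcode J = (f @: fullv)%VS.
  apply/vspaceP => M; apply/idP/memv_imgP => [/basis_mx_factor[X ->]|[X _ ->]].
    by exists X; rewrite ?memvf // lfunE.
  rewrite lfunE; apply/mem_colcode => y; rewrite /= -mulmxA mulmx_sum_col.
  apply: memv_suml => j _; rewrite col_basis_mx; apply/memvZ/vbasis_mem/mem_nth.
  by rewrite size_tuple.
rewrite limg_dim_eq ?dimvf ?dim_matrix; first exact: mulnC.
apply/eqP; rewrite -subv0; apply/subvP => X; rewrite memv_cap memv_ker lfunE memv0.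
move=> /andP[_ /eqP h]; apply/eqP/mulmx_cV_eq0 => y; apply: (@basis_mx_inj J).
by rewrite mulmxA [X in X *m _]h mul0mx.
Qed.

Lemma rank_colcode J M : M \in colcode J -> (\rank M <= \dim J)%N.
Proof. by move=> /basis_mx_factor[X ->]; apply: mulmx_max_rank. Qed.

Lemma rank_maxrk V M : M \in V -> (\rank M <= maxrk V)%N.
Proof.
by move=> MV; apply: (@leq_bigmax_cond _ (fun N => N \in V) (fun N => \rank N)).
Qed.

(** By [dim_code_le] the dimension forces the maximal rank up to [r]. *)
Lemma optimal_of_rank V r : (0 < m)%N -> (n <= m)%N ->
  {in V, forall M, (\rank M <= r)%N} -> \dim V = (m * r)%N -> optimal_anticode V.
Proof.
move=> m0 nm hr dV; rewrite /optimal_anticode dV; congr muln; apply/eqP.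
rewrite eqn_leq -(leq_pmul2l m0) -dV; apply/andP; split.
  by apply: dim_code_le nm _ => M; apply: rank_maxrk.
by apply/bigmax_leqP.
Qed.

Lemma optimal_colcode J : (0 < m)%N -> (n <= m)%N -> optimal_anticode (colcode J).
Proof.
move=> m0 nm; apply: optimal_of_rank m0 nm _ (dim_colcode J) => M.
exact: rank_colcode.
Qed.

End ColumnCodes.

(** * Orthogonal complements *)

Section Orthogonal.
Variables (F : finFieldType) (n : nat).
Implicit Types (J : {vspace 'cV[F]_n}) (u v : 'cV[F]_n).

(** Taking the span adds nothing: the listed vectors already form an intersection of kernels. *)
Lemma mem_cperp J v : reflect (forall u, u \in J -> cdot u v = 0) (v \in cperp J).
Proof.
pose f u : 'Hom('cV[F]_n, 'cV[F]_1) := linfun (mulmx u^T).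
have fE u w : (f u w == 0) = (cdot u w == 0).
  rewrite lfunE /=; apply/eqP/eqP => [/matrixP/(_ 0 0)|h].
    by rewrite !mxE => <-; apply: eq_bigr => k _; rewrite mxE.
  by apply/matrixP => i j; rewrite !ord1 !mxE -[RHS]h; apply: eq_bigr => k _; rewrite mxE.
have -> : cperp J = (\bigcap_(u : 'cV[F]_n | u \in J) lker (f u))%VS.
  apply/eqP; rewrite eqEsubv; apply/andP; split.
    apply/span_subvP => w; rewrite mem_filter => /andP[/forallP h _].
    rewrite memvE; apply/subv_bigcapP => u uJ; rewrite -memvE memv_ker fE.
    by have /implyP := h u; apply.
  apply/subvP => w; rewrite memvE => /subv_bigcapP h; apply: memv_span.
  rewrite mem_filter mem_enum andbT; apply/forallP => u; apply/implyP => uJ.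
  by have := h u uJ; rewrite -memvE memv_ker fE.
rewrite memvE; apply: (iffP subv_bigcapP) => h u uJ.
  by apply/eqP; rewrite -fE -memv_ker memvE h.
by rewrite -memvE memv_ker fE h.
Qed.

Lemma dim_cperp J : \dim (cperp J) = (n - \dim J)%N.
Proof.
pose f : 'Hom('cV[F]_n, 'cV[F]_(\dim J)) := linfun (mulmx (basis_mx J)^T).
have fE v i : f v i 0 = cdot (vbasis J)`_i v.
  by rewrite lfunE mxE; apply: eq_bigr => k _; rewrite !mxE.
have -> : cperp J = lker f.
  apply/vspaceP => v; rewrite memv_ker; apply/mem_cperp/eqP => [h|h u uJ].
    apply/colP => i; rewrite fE mxE h // vbasis_mem // mem_nth //.
    by rewrite size_tuple.
  rewrite (coord_vbasis uJ) /cdot.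
  under eq_bigr => k _ do rewrite summxE mulr_suml.
  rewrite exchange_big big1 // => i _.
  under eq_bigr => k _ do rewrite mxE -mulrA.
  by rewrite -mulr_sumr -/(cdot _ _) -fE h mxE mulr0.
(* The right inverse [D] makes [f] surjective, so rank-nullity gives the dimension. *)
have /row_freeP[D hD] : row_free (basis_mx J)^T.
  apply: inj_row_free => v hv; apply: trmx_inj; rewrite trmx0; apply: basis_mx_inj.
  by rewrite -[basis_mx J]trmxK -trmx_mul hv trmx0.
have := limg_ker_dim f fullv; rewrite capfv dimvf dim_cV.
suff -> : (f @: fullv = fullv)%VS by rewrite dimvf dim_cV => /(canRL (addnK _)).
apply/eqP; rewrite eqEsubv subvf /=; apply/subvP => w _; apply/memv_imgP.
by exists (D *m w); rewrite ?memvf // lfunE /= mulmxA hD mul1mx.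
Qed.

Lemma cperpK J : cperp (cperp J) = J.
Proof.
apply/esym/eqP; rewrite eqEdim !dim_cperp subKn; last first.
  by rewrite -[X in (_ <= X)%N](dim_cV F n) -dimvf dimvS ?subvf.
rewrite leqnn andbT; apply/subvP => u uJ; apply/mem_cperp => v /mem_cperp h.
by rewrite -(h u uJ); apply: eq_bigr => k _; rewrite mulrC.
Qed.

End Orthogonal.

(** * Generalized weights *)

Section Minimum.
Implicit Types P Q : nat -> Prop.

Lemma natminP P : (exists k, P k) ->
  P (natmin P) /\ (forall k, P k -> (natmin P <= k)%N).
Proof.
rewrite /natmin; case: pselect => // ex _; case: ex_minnP => k /asboolP Pk hmin.
by split=> // l Pl; apply/hmin/asboolP.
Qed.

Lemma natmin_eq P Q : (forall k, P k <-> Q k) -> natmin P = natmin Q.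
Proof. by move=> h; congr natmin; apply/funext => k; apply/propext. Qed.

Lemma natmin_mul P Q c : (exists k, Q k) -> (forall k, Q k -> P (c * k)%N) ->
  (forall d, P d -> exists2 k, d = (c * k)%N & Q k) -> natmin P = (c * natmin Q)%N.
Proof.
move=> exQ QP PQ; have [Qm minQ] := natminP exQ.
have [|Pm minP] := @natminP P; first by exists (c * natmin Q)%N; apply: QP.
apply/eqP; rewrite eqn_leq minP /=; last exact: QP.
by have [k -> Qk] := PQ _ Pm; rewrite leq_mul2l (minQ k Qk) orbT.
Qed.

Lemma natmin_or P Q : (exists k, P k) -> (exists k, Q k) ->
  natmin (fun k => P k \/ Q k) = minn (natmin P) (natmin Q).
Proof.
move=> exP exQ; have [Pm minP] := natminP exP; have [Qm minQ] := natminP exQ.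
have [|h hmin] := @natminP (fun k => P k \/ Q k).
  by exists (natmin P); left.
apply/eqP; rewrite eqn_leq leq_min !hmin; [|by right|by left].
by case: h => [/minP|/minQ] h; rewrite geq_min h ?orbT.
Qed.

End Minimum.

Section Weights.
Variables (F : finFieldType) (n m : nat).
Implicit Types (C V A : {vspace 'M[F]_(n, m)}).

(* The classification of optimal anticodes (Dieudonne, Meshulam). *)
Theorem anticode_contained V r : (0 < n)%N -> (n <= m)%N -> (r <= n)%N ->
  {in V, forall M, (\rank M <= r)%N} -> \dim V = (m * r)%N ->
  (exists2 J, \dim J = r & (V <= colcode m J)%VS) \/
  (n = m /\ exists2 K, \dim K = r & (trv V <= colcode n K)%VS).
Proof.
move=> n0 nm rn rkV dV.
have toC (J : {vspace 'cV[F]_n}) : {in V, forall M, forall y, M *m y \in J} ->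
    (V <= colcode m J)%VS.
  by move=> h; apply/subvP => M MV; apply/mem_colcode => y; apply: h.
have [r0|r_gt0] := posnP r.
  left; exists 0%VS; first by rewrite dimv0 r0.
  by move/eqP: dV; rewrite r0 muln0 dimv_eq0 => /eqP ->; apply: sub0v.
move: rn; rewrite leq_eqVlt => /orP[/eqP rn|rn].
  left; exists fullv; first by rewrite dimvf dim_cV.
  by apply: toC => M _ y; apply: memvf.
have [[x dx]|hx] := pselect (exists x, \dim (ev n x @: V) = r).
  have [J dJ hJ] := column_case r_gt0 rn nm rkV dV dx.
  by left; exists J => //; apply: toC.
have {}hx x : \dim (ev n x @: V) != r by apply/eqP => dx; apply: hx; exists x.
have m0 : (0 < m)%N by apply: leq_trans n0 nm.
have [x x0] : exists x : 'cV[F]_m, x != 0.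
  exists (const_mx 1); apply/eqP => /matrixP/(_ (Ordinal m0) 0) /eqP.
  by rewrite !mxE oner_eq0.
have fx : free ([::] ++ [:: x]) by rewrite seq1_free.
(* No [V x] has dimension [r], so a single nonzero [x] already forces n = m, and the transpose can
   be examined in the same way. *)
have [enm _] := csteps_0f r_gt0 rn nm rkV dV fx (hx x).
right; split=> //; subst m.
have rkT : {in trv V, forall M, (\rank M <= r)%N}.
  by move=> M; rewrite mem_trv -mxrank_tr => /rkV.
have dT : \dim (trv V) = (n * r)%N by rewrite dim_trv.
have [[y dy]|hy] := pselect (exists y, \dim (ev n y @: trv V) = r).
  have [K dK hK] := column_case r_gt0 rn nm rkT dT dy.
  exists K => //; apply/subvP => M MV; apply/mem_colcode => z; exact: hK.
exfalso; apply: (square_case r_gt0 rn rkV dV hx) => y.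
by apply/eqP => dy; apply: hy; exists y.
Qed.

Definition col_support C i k :=
  exists2 J : {vspace 'cV[F]_n}, (i <= \dim (C :&: colcode m J))%N & \dim J = k.

Lemma col_support_ex C i : (i <= \dim C)%N -> exists k, col_support C i k.
Proof.
move=> iC; exists (\dim (fullv : {vspace 'cV[F]_n})); exists fullv => //.
suff -> : (C :&: colcode m fullv = C)%VS by [].
by apply/capv_idPl/subvP => M _; apply/mem_colcode => y; apply: memvf.
Qed.

(** Passing to the complement turns [n - \dim J] into a dimension, and m cancels the denominator of
    [rho_c]. *)
Lemma gen_weight_cE C i : (0 < m)%N -> gen_weight_c C i = natmin (col_support C i).
Proof.
move=> m0; apply: natmin_eq => k.
have cond J : (i%:R <= (\dim C)%:R - m%:R * rho_c C J) =
    (i <= \dim (C :&: colcode m (cperp J)))%N.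
  rewrite /rho_c mulrC divfK ?pnatr_eq0 -?lt0n // subKr -subcode_cE.
  exact: ler_nat.
split=> [[J []]|[J iJ dJ]].
  by rewrite cond => iJ ->; exists (cperp J); rewrite ?dim_cperp.
exists (cperp J); rewrite cond cperpK; split=> //.
by rewrite -dJ -{1}[J]cperpK dim_cperp.
Qed.

End Weights.

(** * Row data as column data of the transpose, and comparison of the minima *)

Section Transposition.
Variables (F : finFieldType) (n m : nat).
Implicit Types (C : {vspace 'M[F]_(n, m)}).

Lemma trv_rowsp (M : 'M[F]_(n, m)) : trv (rowsp M) = colsp M^T.
Proof.
rewrite /trv limg_span; apply: eq_span => u; rewrite -map_comp.
by congr (_ \in _); apply: eq_map => j /=; rewrite lfunE /= tr_row.
Qed.

Lemma trv_sub (a b : nat) (U V : {vspace 'M[F]_(a, b)}) :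
  (trv U <= trv V)%VS = (U <= V)%VS.
Proof.
apply/idP/idP => [h|]; last exact: limgS.
by rewrite -[U]trvK -[V]trvK; apply: limgS.
Qed.

Lemma trv_rperp (K : {vspace 'rV[F]_m}) : trv (rperp K) = cperp (trv K).
Proof.
rewrite /trv limg_span; apply: eq_span => u.
apply/mapP/idP => [[v]|].
  rewrite mem_filter => /andP[/forallP h _] ->; rewrite mem_filter mem_enum andbT.
  apply/forallP => w; apply/implyP; rewrite mem_trv lfunE /= => wK.
  have /implyP/(_ wK)/eqP <- := h w^T; apply/eqP; apply: eq_bigr => k _.
  by rewrite !mxE.
rewrite mem_filter => /andP[/forallP h _]; exists u^T; last by rewrite lfunE /= trmxK.
rewrite mem_filter mem_enum andbT; apply/forallP => w; apply/implyP => wK.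
have /implyP := h w^T; rewrite mem_trv trmxK => /(_ wK)/eqP <-.
by apply/eqP; apply: eq_bigr => k _; rewrite !mxE.
Qed.

Lemma trv_subcode_r C K : trv (subcode_r C K) = subcode_c (trv C) (trv K).
Proof.
rewrite /trv limg_span; apply: eq_span => u.
apply/mapP/idP => [[M]|].
  rewrite mem_filter => /andP[/andP[MC hM] _] ->; rewrite mem_filter mem_enum andbT.
  rewrite mem_trv lfunE /= trmxK MC /=.
  by rewrite -trv_rowsp trv_sub.
rewrite mem_filter mem_trv => /andP[/andP[uC hu] _].
exists u^T; last by rewrite lfunE /= trmxK.
by rewrite mem_filter mem_enum andbT uC /= -trv_sub trv_rowsp trmxK.
Qed.

Lemma gen_weight_r_tr C i : gen_weight_r C i = gen_weight_c (trv C) i.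
Proof.
have hrho K : rho_r C K = rho_c (trv C) (trv K).
  by rewrite /rho_r /rho_c -trv_rperp -trv_subcode_r !dim_trv.
apply: natmin_eq => k; split=> [[K [hK ->]]|[J [hJ ->]]].
  by exists (trv K); rewrite -hrho !dim_trv.
by exists (trv J); rewrite hrho trvK [\dim (trv J)]dim_trv -(dim_trv C).
Qed.

(** Serves n < m and n = m alike: anticode dimensions are m times support dimensions, so the factor
    1/m cancels. *)
Lemma gen_weight_natmin C i (Q : nat -> Prop) : (0 < n)%N -> (n <= m)%N ->
  (exists k, Q k) ->
  (forall k, Q k <-> col_support C i k \/ n = m /\ col_support (trv C) i k) ->
  gen_weight C i = (natmin Q)%:R.
Proof.
move=> n0 nm exQ hQ; have m0 : (0 < m)%N by apply: leq_trans n0 nm.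
rewrite /gen_weight (@natmin_mul _ Q m) //.
- by rewrite natrM mulrAC mulfV ?mul1r // pnatr_eq0 -lt0n.
- move=> k /hQ[[J iJ <-]|[enm [K iK <-]]].
    exists (colcode m J); rewrite dim_colcode; split=> //.
    exact: optimal_colcode.
  have dK : \dim (trv (colcode n K)) = (m * \dim K)%N.
    by rewrite dim_trv dim_colcode; congr (_ * _)%N.
  exists (trv (colcode n K)); split=> //.
    apply: optimal_of_rank m0 nm _ dK => M.
    by rewrite mem_trv -mxrank_tr; apply: rank_colcode.
  rewrite -dim_trv; apply: leq_trans iK (dimvS _).
  by apply/subvP => M; rewrite memv_cap !mem_trv memv_cap mem_trv trmxK.
(* Conversely, the classification puts [A] inside a column or row code whose support has dimension
   [maxrk A]; enlarging [A] keeps the intersection large enough. *)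
move=> d [A [optA iA <-]]; exists (maxrk A); first exact: optA.
apply/hQ; have rkA : {in A, forall M, (\rank M <= maxrk A)%N}.
  by move=> M; apply: rank_maxrk.
have rn : (maxrk A <= n)%N by apply/bigmax_leqP => M _; apply: rank_leq_row.
have [[J dJ AJ]|[enm [K dK AK]]] := anticode_contained n0 nm rn rkA optA.
  by left; exists J => //; apply: leq_trans iA (dimvS (capvS _ AJ)).
right; split=> //; exists K => //; apply: leq_trans iA _.
rewrite -dim_trv; apply/dimvS/subvP => M; rewrite mem_trv !memv_cap mem_trv.
by case/andP=> -> MA; apply: (subvP AK); rewrite mem_trv.
Qed.

End Transposition.

Unset Implicit Arguments.
Set Strict Implicit.

(* F is a finite field (of order q, a prime power); Mat = 'M[F]_(n, m). *)
Theorem theorem6p1 (F : finFieldType) (n m : nat)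
  (C : {vspace 'M[F]_(n, m)}) (i : nat) :
  (2 <= n)%N -> (n <= m)%N -> C != 0%VS ->
  (1 <= i)%N -> (i <= \dim C)%N ->
  ((n < m)%N -> gen_weight C i = (gen_weight_c C i)%:R) /\
  (n = m -> gen_weight C i = (minn (gen_weight_c C i) (gen_weight_r C i))%:R).
Proof.
move=> n2 nm _ _ iC.
have n0 : (0 < n)%N by apply: leq_trans n2.
have m0 : (0 < m)%N by apply: leq_trans n0 nm.
have exC := col_support_ex iC.
have exT : exists k, col_support (trv C) i k by apply: col_support_ex; rewrite dim_trv.
rewrite gen_weight_r_tr !gen_weight_cE //; split=> [lt_nm|enm].
  apply: gen_weight_natmin => // k; split=> [|[//|[e _]]]; first by left.
  by rewrite e ltnn in lt_nm.
(* For n = m both kinds of support are allowed, and the minimum over the union is the smaller of the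
   two minima. *)
rewrite -natmin_or //; apply: gen_weight_natmin => //.
  by case: exC => k hk; exists k; left.
by move=> k; split=> [[hk|hk]|[hk|[_ hk]]]; [left|right|left|right].
Qed.
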